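(* Let $\lambda$ be a cardinal with $\lambda<\mathfrak s$. Then every sequentially compact topological space $X$ with $w(X)<\mathfrak s$ is $\lambda$-ssc.
   Context: $[\omega]^\omega$ is the set of all infinite subsets of $\omega$. A sequence $x=\langle x_n:n<\omega\rangle$ converges along $H\in[\omega]^\omega$ if the subsequence $x\upharpoonright H=\langle x_n:n\in H\rangle$ converges to some point. A topological space $X$ is $\lambda$-simultaneously sequentially compact ($\lambda$-ssc) if for any $\lambda$-many sequences with values in $X$ there is $H\in[\omega]^\omega$ such that each of those sequences converges along $H$. No separation axioms are assumed. A family $\mathcal S\subseteq[\omega]^\omega$ is splitting if for every $A\in[\omega]^\omega$ there is $S\in\mathcal S$ with $A\cap S$ and $A\setminus S$ both infinite; the splitting number $\mathfrak s$ is the least cardinality of a splitting family. The weight is $w(X)=\aleph_0+\min\{|\mathcal B|:\mathcal B\text{ is a basis for the topology on }X\}$. *)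

(* Defs.v *)
From HB Require Import structures.
From mathcomp Require Import all_boot all_order.
From mathcomp Require Import mathcomp_extra boolp classical_sets functions.
From mathcomp Require Import cardinality filter topology.

Set Implicit Arguments.
Unset Strict Implicit.
Unset Printing Implicit Defensive.

Local Open Scope classical_set_scope.
Local Open Scope card_scope.

(* A cardinal is represented by any set (or, as [set: L], any type L) of that
   cardinality; only #<= and the strict comparison below are applied to it. *)
Definition card_lt T U (A : set T) (B : set U) : Prop :=
  A #<= B /\ ~ (B #<= A).

Notation "A '#<' B" := (card_lt A B) (at level 79) : card_scope.

Section LeastCardinality.
Variable T : Type.
Implicit Types (P : set (set T)) (A B : set T).

Definition is_least_card P A := P A /\ forall B, P B -> A #<= B.

(* Cardinals are well-ordered: take a maximal set F of choice functions for P
   whose evaluations at members of P are injective. *)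
Lemma least_card_exists P : P !=set0 -> exists A, is_least_card P A.
Proof.
move=> [A0 PA0].
pose Q (F : set (set T -> T)) :=
  (forall f, F f -> forall B, P B -> B (f B)) /\
  (forall f g, F f -> F g -> forall B, P B -> f B = g B -> f = g).
have [F [[Fch Finj] Fmax]] : exists F, Q F /\ forall G, F `<` G -> ~ Q G.
  apply: Zorn_bigcup => C CQ Ctot; split=> [f [G CG Gf]|f g [G CG Gf] [H CH Hg]].
    exact: (CQ _ CG).1.
  have [GH|HG] := Ctot _ _ CG CH.
    exact: (CQ _ CH).2 (GH _ Gf) Hg.
  exact: (CQ _ CG).2 Gf (HG _ Hg).
have [A PA Asub] : exists2 A, P A & A `<=` (fun f => f A) @` F.
  apply: contrapT => noA.
  have miss B : P B -> exists b, B b /\ ~ ((fun f => f B) @` F) b.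
    move=> PB; apply: contrapT => nob; apply: noA; exists B => // b Bb.
    by apply: contrapT => nFb; apply: nob; exists b.
  have [b0 _] := miss _ PA0.
  have /choice[h hP] B : exists b, P B -> B b /\ ~ ((fun f => f B) @` F) b.
    by have [/miss[b]|] := pselect (P B); [exists b | exists b0].
  apply: (Fmax (F `|` [set h])); last split.
  - split; first by move=> f Ff; left.
    by move=> sub; case: (hP _ PA0) => _ []; exists h => //; apply: sub; right.
  - by move=> f [Ff B|-> B PB]; [exact: Fch | exact: (hP _ PB).1].
  - move=> f g [Ff|->] [Fg|->] B PB // e.
    + exact: Finj e.
    + by case: (hP _ PB) => _ []; exists f.
    + by case: (hP _ PB) => _ []; exists g.
exists A; split=> // B PB.
apply: card_le_trans (subset_card_le Asub) _.
apply: card_le_trans (card_image_le _ _) _.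
have : (fun f => f B) @` F #= F.
  by apply: inj_card_eq => f g /set_mem Ff /set_mem Fg fg; exact: Finj fg.
rewrite card_eq_le => /andP[_ leFB]; apply: card_le_trans leFB _.
by apply: subset_card_le => _ [f Ff <-]; exact: Fch f Ff B PB.
Qed.

Definition least_card P (P0 : P !=set0) : set T :=
  sval (cid (least_card_exists P0)).

Lemma least_cardP P (P0 : P !=set0) : is_least_card P (least_card P0).
Proof. exact: svalP (cid (least_card_exists P0)). Qed.

End LeastCardinality.

Definition splitting (S : set (set nat)) : Prop :=
  S `<=` [set H | infinite_set H] /\
  forall A, infinite_set A ->
    exists2 B, S B & infinite_set (A `&` B) /\ infinite_set (A `\` B).

Lemma splitting_nonempty : splitting !=set0.
Proof.
exists [set H | infinite_set H]; split=> // A.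
move=> /infiniteP/pcard_leP[f].
have f_inj : injective f by move=> m n; apply: (@inj _ _ _ f); rewrite in_setT.
have infR (g : nat -> nat) : injective g -> infinite_set (range (f \o g)).
  move=> g_inj; apply/infiniteP.
  have /(inj_card_eq (A := setT)) : {in setT &, injective (f \o g)}.
    by move=> m n _ _ /f_inj /g_inj.
  by rewrite card_eq_le => /andP[].
have dbl_inj : injective double by move=> m n /(congr1 half); rewrite !doubleK.
exists (range (f \o double)); first exact: infR.
split; last first.
  apply: (@sub_infinite_set _ (range (f \o (succn \o double)))).
    move=> _ [n _ <-] /=; split; first exact: funS.
    move=> [m _ /f_inj /(congr1 odd)] /=.
    by rewrite !odd_double.
  by apply: infR => m n [] /dbl_inj.
apply: (@sub_infinite_set _ (range (f \o double))); last exact: infR.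
by move=> _ [n _ <-] /=; split; [exact: funS | exists n].
Qed.

Definition splitting_number : set (set nat) := least_card splitting_nonempty.

Lemma basis_nonempty (X : topologicalType) : @basis X !=set0.
Proof.
exists open; split=> // x U /=.
by rewrite nbhsE => -[V [oV Vx] VU]; exists V.
Qed.

(* The union below is a disjoint sum of omega with a basis of least size. *)
Definition weight (X : topologicalType) : set (nat + set X) :=
  range inl `|` inr @` least_card (basis_nonempty X).
Arguments weight : clear implicits.

Definition converges_along (X : topologicalType) (H : set nat) (x : nat -> X)
    : Prop :=
  exists l : X, x @ within H \oo --> l.

Definition ssc (L : Type) (X : topologicalType) : Prop :=
  forall x : L -> nat -> X, exists H : set nat,
    infinite_set H /\ forall i, converges_along H (x i).

Definition sequentially_compact (X : topologicalType) : Prop :=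
  forall x : nat -> X, exists H : set nat,
    infinite_set H /\ converges_along H x.

(* Main.v *)
Require Import Defs.
From mathcomp Require Import all_boot all_order.
From mathcomp Require Import boolp classical_sets functions cardinality.
From mathcomp Require Import filter topology.

Local Open Scope classical_set_scope.
Local Open Scope card_scope.

(** Write [kappa] for the larger of [L] and the weight of [X]. It is infinite,
    because the weight is, and it lies below the splitting number.

    Let [B] be a basis of least size. The sets [{n | x i n \in U}], for [i] in
    [L] and [U] in [B], number at most [kappa * kappa = kappa], so they do not
    form a splitting family: there is an infinite [H] that each of them either
    almost contains or almost misses ([unsplit_exists]). Along such an [H] every
    [x i] converges ([unsplit_converges_along]). Indeed sequential compactness
    applied to [x i] listed along [H] yields a limit [l] of some subsequence;
    a basic neighbourhood [U] of [l] contains [x i n] for infinitely many [n] in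
    [H], hence for all but finitely many [n] in [H].

    The cardinal arithmetic is done here as well: cardinals are comparable
    ([card_le_total]), and [kappa * kappa = kappa] for infinite [kappa]
    ([card_le_setXX]). The latter is Zorn's argument: take a maximal partial
    injection from some infinite square [D `*` D] into [D], with [D] inside
    [A]. If [A `\` D] were at least as large as [D], a copy of [D] in it would
    leave room for a larger injection; so [A `\` D] is at most as large as [D],
    hence [A] is too. *)

(** * Cardinal arithmetic *)

(** A relation on the whole types can describe an injection that is defined on
    [A] only, even into an empty type; an injection defined by cases becomes a
    disjunction. *)
Lemma card_leRP {T U : Type} (A : set T) (B : set U) :
  A #<= B <-> exists R : T -> U -> Prop,
    (forall a, A a -> exists2 b, B b & R a b) /\
    (forall a a' b, A a -> A a' -> R a b -> R a' b -> a = a').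
Proof.
elim/Ppointed: U => U in B *.
  split=> [|[R [Rtot _]]].
    by rewrite card_le_emptyr => /eqP ->; exists (fun _ _ => False); split.
  rewrite card_le_emptyr; apply/eqP/seteqP; split=> // a /Rtot[b].
  by case: (no b).
split=> [/pcard_leP/injfunPex[f fAB f_inj]|[R [Rtot Rinj]]].
  exists (fun a b => b = f a); split=> [a Aa|a a' b Aa Aa' -> e].
    by exists (f a) => //; exact: fAB.
  by apply: f_inj; rewrite ?inE.
have /choice[f fP] a : exists b, A a -> B b /\ R a b.
  by have [/Rtot[b Bb Rb]|nAa] := pselect (A a); [exists b | exists point].
apply/pcard_leP/injfunPex; exists f => [a /fP[]//|a a' /set_mem Aa /set_mem Aa' e].
by apply: (Rinj _ _ (f a)) => //; [|rewrite e]; apply: (fP _ _).2.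
Qed.

(** Two embeddings decide this: [A] and [B] are the only members of a family of
    subsets of [T + U], and a family of sets has a member of least cardinality. *)
Lemma card_le_total {T U : Type} (A : set T) (B : set U) :
  A #<= B \/ B #<= A.
Proof.
have [C [PC Cmin]] := @least_card_exists (T + U)
  [set (@inl T U) @` A; (@inr T U) @` B] (ex_intro _ _ (or_introl erefl)).
have inlA : (@inl T U) @` A #= A by apply: inj_card_eq => x y _ _ [].
have inrB : (@inr T U) @` B #= B by apply: inj_card_eq => x y _ _ [].
rewrite -(card_le_eql inlA) -(card_le_eqr inlA).
rewrite -(card_le_eql inrB) -(card_le_eqr inrB).
case: PC => CE; rewrite CE in Cmin.
- by left; apply: Cmin; right.
- by right; apply: Cmin; left.
Qed.

Lemma infinite_image {T U : Type} {f : T -> U} {A : set T} :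
  {in A &, injective f} -> infinite_set A -> infinite_set (f @` A).
Proof.
move=> /inj_card_eq fA; apply: contra_not; apply: card_le_finite.
by rewrite (card_le_eqr fA).
Qed.

Lemma card_le_setX {T U T' U' : Type}
    {A : set T} {B : set U} {A' : set T'} {B' : set U'} :
  A #<= A' -> B #<= B' -> A `*` B #<= A' `*` B'.
Proof.
move=> /card_leRP[R [Rtot Rinj]] /card_leRP[S [Stot Sinj]].
apply/card_leRP; exists (fun p q => R p.1 q.1 /\ S p.2 q.2); split.
  move=> [a b] [/= /Rtot[a' A'a' Raa'] /Stot[b' B'b' Sbb']].
  by exists (a', b').
move=> [a b] [a1 b1] [a' b'] [/= Aa Bb] [/= Aa1 Bb1] [Ra Sb] [Ra1 Sb1].
by rewrite (Rinj _ _ _ Aa Aa1 Ra Ra1) (Sinj _ _ _ Bb Bb1 Sb Sb1).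
Qed.

(** The union maps into the square [C `*` C], the first coordinate being a tag
    that tells [A] from [B `\` A]. *)
Lemma card_le_setU {T U : Type} {A B : set T} {C : set U} :
  infinite_set C -> C `*` C #<= C -> A #<= C -> B #<= C -> A `|` B #<= C.
Proof.
move=> infC CC /card_leRP[R [Rtot Rinj]] /card_leRP[S [Stot Sinj]].
have [c0 Cc0] := infinite_setN0 infC.
have [c1 [Cc1 c10]] := infinite_setN0 (infinite_setD infC (finite_set1 c0)).
apply: card_le_trans CC; apply/card_leRP.
exists (fun x p => A x /\ p.1 = c0 /\ R x p.2 \/
                   ~ A x /\ B x /\ p.1 = c1 /\ S x p.2).
split=> [x ABx|x y [c d] _ _ /= Hx Hy].
  have [Ax|nAx] := pselect (A x).
    by have [d Cd Rxd] := Rtot _ Ax; exists (c0, d) => //; left.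
  have Bx : B x by case: ABx.
  by have [d Cd Sxd] := Stot _ Bx; exists (c1, d) => //; right.
case: Hx => [[Ax [cx Rx]]|[nAx [Bx [cx Sx]]]];
case: Hy => [[Ay [cy Ry]]|[nAy [By [cy Sy]]]].
- exact: Rinj Rx Ry.
- by case: c10; rewrite -cx -cy.
- by case: c10; rewrite -cx -cy.
- exact: Sinj Sx Sy.
Qed.

Section Square.
Context {T : Type}.
Implicit Types (A D : set T) (G : set (T * T * T)).

(** [G] is the graph of a map from pairs to elements; its domain, a square, is
    read off from the diagonal. *)
Definition square_side G : set T := [set a | exists c, G (a, a, c)].

Definition square_injection A G : Prop :=
  [/\ square_side G `<=` A,
      forall p q c, G (p, c) -> G (q, c) -> p = q,
      forall a b, square_side G a -> square_side G b -> exists c, G (a, b, c)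
    & forall p c, G (p, c) -> square_side G c].

Lemma square_injection_card {A G} :
  square_injection A G -> square_side G `*` square_side G #<= square_side G.
Proof.
move=> [_ Ginj Gtot Gcl]; apply/card_leRP.
exists (fun p c => G (p, c)); split=> [[a b] [/= Da Db]|p q c _ _].
  by have [c Gc] := Gtot _ _ Da Db; exists c => //; exact: Gcl Gc.
exact: Ginj.
Qed.

Lemma square_injection_bigcup {A} {F : set (set (T * T * T))} :
  F `<=` square_injection A -> total_on F subset ->
  square_injection A (\bigcup_(G in F) G).
Proof.
move=> FA Ftot.
(* Each clause concerns at most two triples, and these lie in one member. *)
have F2 p q : (\bigcup_(G in F) G) p -> (\bigcup_(G in F) G) q ->
    exists2 G, F G & G p /\ G q.
  move=> [G FG Gp] [H FH Hq].
  have [GH|HG] := Ftot _ _ FG FH.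
    by exists H => //; split=> //; exact: GH.
  by exists G => //; split=> //; exact: HG.
split.
- move=> a [c [G FG Gc]]; have [sub _ _ _] := FA _ FG.
  by apply: sub; exists c.
- move=> p q c Gp Gq; have [G FG [{}Gp {}Gq]] := F2 _ _ Gp Gq.
  by have [_ Ginj _ _] := FA _ FG; exact: Ginj Gp Gq.
- move=> a b [c Ga] [d Gb]; have [G FG [{}Ga {}Gb]] := F2 _ _ Ga Gb.
  have [_ _ Gtot _] := FA _ FG.
  have [|| e Ge] := Gtot a b; [by exists c | by exists d |].
  by exists e, G.
- move=> p c [G FG Gp]; have [_ _ _ Gcl] := FA _ FG.
  by have [d Gd] := Gcl _ _ Gp; exists d, G.
Qed.

(** The pairing function on the natural numbers, carried over to a countable
    subset of [A]. *)
Lemma infinite_square_injection {A} : infinite_set A ->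
  exists2 G, square_injection A G & infinite_set (square_side G).
Proof.
move=> /infiniteP/card_leRP[R [Rtot Rinj]].
have /choice[f fP] n : exists a, A a /\ R n a.
  by have [a] := Rtot n I; exists a.
have f_inj : injective f.
  move=> m n e; apply: (Rinj _ _ (f m)) => //; first exact: (fP m).2.
  by rewrite e; exact: (fP n).2.
pose G : set (T * T * T) :=
  [set (f mn.1, f mn.2, f (pickle mn)) | mn in [set: nat * nat]].
have sideG : square_side G = range f.
  apply/seteqP; split=> [a [c [[m n] _ [<- _ _]]]|_ [n _ <-]]; first by exists m.
  by exists (f (pickle (n, n))), (n, n).
exists G.
  split; rewrite ?sideG.
  - by move=> _ [n _ <-]; exact: (fP n).1.
  - move=> p q c [mn _ [<- e]] [mn' _ [<- e']].
    have /f_inj/(pcan_inj pickleK) -> // : f (pickle mn) = f (pickle mn').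
    by rewrite e e'.
  - by move=> _ _ [m _ <-] [n _ <-]; exists (f (pickle (m, n))), (m, n).
  - by move=> p c [mn _ [_ <-]]; exists (pickle mn).
rewrite sideG; apply: infinite_image infinite_nat => m n _ _; exact: f_inj.
Qed.

(** With [E] a copy of [D] outside [D], the square of [D `|` E] is no larger
    than [D], so the new pairs can be sent injectively into [E], where they
    meet no old value. *)
Lemma square_injection_extend {A G} :
  square_injection A G -> infinite_set (square_side G) ->
  square_side G #<= A `\` square_side G ->
  exists2 G', square_injection A G' & G `<` G'.
Proof.
move=> GA infD; have DD := square_injection_card GA.
move: GA; set D := square_side G in infD DD * => GA.
move=> /card_subP[E ED Esub].
have DE : D #<= E by rewrite (card_le_eqr ED).
have DUE : D `|` E #<= D by apply: card_le_setU => //; rewrite (card_le_eql ED).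
have /card_leRP[R [Rtot Rinj]] : (D `|` E) `*` (D `|` E) #<= E.
  by apply: card_le_trans DE; apply: card_le_trans DD; exact: card_le_setX.
have [GsubA Ginj Gtot Gcl] := GA.
pose H : set (T * T * T) := [set pc | [/\ ((D `|` E) `*` (D `|` E)) pc.1,
  ~ (D `*` D) pc.1, E pc.2 & R pc.1 pc.2]].
have sideU : square_side (G `|` H) = D `|` E.
  apply/seteqP; split=> [a [c [Gc|[[]]//]]|a]; first by left; exists c.
  have [[c Gc] _|nDa [//|Ea]] := pselect (D a); first by exists c; left.
  have [|c Ec Rc] := Rtot (a, a); first by split; right.
  by exists c; right; split=> //; [split; right | case].
exists (G `|` H).
  split; rewrite ?sideU.
  - by move=> a [/GsubA//|/Esub[]].
  - have disj p q c : G (p, c) -> H (q, c) -> p = q.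
      by move=> /Gcl Dc [_ _ /Esub[]].
    move=> p q c [Gp|Hp] [Gq|Hq]; first exact: Ginj Gp Gq.
    + exact: disj Gp Hq.
    + by rewrite (disj _ _ _ Gq Hp).
    + by case: Hp Hq => DEp _ _ Rp [DEq _ _ Rq]; exact: Rinj Rp Rq.
  - move=> a b DEa DEb; have [[Da Db]|nD] := pselect ((D `*` D) (a, b)).
      by have [c Gc] := Gtot _ _ Da Db; exists c; left.
    by have [//|c Ec Rc] := Rtot (a, b); exists c; right.
  - by move=> p c [/Gcl|[_ _ Ec _]]; [left | right].
split; first by move=> p Gp; left.
have [d Dd] := infinite_setN0 infD.
have /card_leRP[S [Stot _]] := DE; have [e Ee _] := Stot _ Dd.
move=> HG; have [c] : square_side (G `|` H) e by rewrite sideU; right.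
by move=> /HG Gc; have [_] := Esub _ Ee; apply; exists c.
Qed.

(** If a partial injection with infinite side is maximal, its side is as large
    as [A]: otherwise a copy of the side outside it yields an extension. The
    empty injection joins the competition as the union of the empty chain; it is
    not maximal, by [infinite_square_injection]. *)
Lemma card_le_setXX {A} : infinite_set A -> A `*` A #<= A.
Proof.
move=> infA.
have [G [[GA Ginf] Gmax]] : exists G,
    (square_injection A G /\ (G !=set0 -> infinite_set (square_side G))) /\
    forall G', G `<` G' ->
      ~ (square_injection A G' /\ (G' !=set0 -> infinite_set (square_side G'))).
  apply: Zorn_bigcup => F FP Ftot; split.
    by apply: square_injection_bigcup => // G /FP[].
  move=> [p [G FG Gp]]; have [_ infG] := FP _ FG.
  apply: sub_infinite_set (infG _); last by exists p.
  by move=> a [c Gc]; exists c, G.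
have G0 : G !=set0.
  apply: contrapT => G0; have [G1 G1A G1inf] := infinite_square_injection infA.
  apply: (Gmax G1) => //; split=> [p Gp|sub]; first by case: G0; exists p.
  have [a [c G1c]] := infinite_setN0 G1inf.
  by apply: G0; exists (a, a, c); exact: sub.
have {Ginf G0} infD := Ginf G0; have DD := square_injection_card GA.
have [DleAD|ADleD] := card_le_total (square_side G) (A `\` square_side G).
  have [G' G'A GG'] := square_injection_extend GA infD DleAD.
  case: (Gmax _ GG'); split=> // _; apply: sub_infinite_set infD.
  by move=> a [c Gc]; exists c; exact: GG'.1.
have AleD : A #<= square_side G.
  apply: card_le_trans (card_le_setU infD DD (card_lexx _) ADleD).
  by apply: subset_card_le => a Aa; have [|] := pselect (square_side G a);
    [left | right].
apply: card_le_trans (card_le_setX AleD AleD) _.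
apply: card_le_trans DD _; apply: subset_card_le.
by have [] := GA.
Qed.

End Square.

(** The larger of the cardinals of [A] and [M] is infinite, hence equal to its
    square, and the square bounds [A `*` B]. *)
Lemma not_card_le_setX {T U V W : Type}
    {A : set T} {B : set U} {M : set V} {S : set W} :
  infinite_set M -> B #<= M -> ~ (S #<= A) -> ~ (S #<= M) ->
  ~ (S #<= A `*` B).
Proof.
move=> infM BM SA SM SAB.
have [AM|MA] := card_le_total A M.
  apply: SM; apply: card_le_trans SAB _.
  by apply: card_le_trans (card_le_setXX infM); exact: card_le_setX.
have infA : infinite_set A.
  by apply/infiniteP; apply: card_le_trans MA; exact/infiniteP.
apply: SA; apply: card_le_trans SAB _.
apply: card_le_trans (card_le_setXX infA); apply: card_le_setX => //.
exact: card_le_trans MA.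
Qed.

(** * Convergence along an unsplit set *)

(** A splitting family may contain infinite sets only, so a small [F] is first
    cut down to its infinite members; a finite one never splits [H]. *)
Lemma unsplit_exists {F : set (set nat)} : ~ (splitting_number #<= F) ->
  exists2 H, infinite_set H &
    forall S, F S -> finite_set (H `&` S) \/ finite_set (H `\` S).
Proof.
move=> sF; apply: contrapT => noH; apply: sF.
apply: (@card_le_trans _ _ _ (F `&` [set S | infinite_set S])); last first.
  by apply: subset_card_le => S [].
apply: (least_cardP splitting_nonempty).2; split=> [S []//|H infH].
apply: contrapT => noS; apply: noH; exists H => // S FS.
apply: contrapT => /not_orP[infI infD]; apply: noS; exists S => //.
by split=> //; apply: sub_infinite_set infI => n [].
Qed.

Lemma finite_nat_bounded {A : set nat} : finite_set A ->
  exists N, forall n, A n -> n < N.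
Proof.
move=> /finite_seqP[s ->]; exists (\max_(n <- s) n).+1 => n /= ns.
by rewrite ltnS; exact: leq_bigmax_seq.
Qed.

(** The limit comes from a convergent subsequence along [H]. A basic
    neighbourhood of it contains infinitely many terms along [H], so of the two
    alternatives only almost containment is left. The listing [e] of elements of
    [H] is injective, not monotone: injectivity already turns infinitely many
    indices into infinitely many elements of [H]. *)
Lemma unsplit_converges_along {X : topologicalType} {B : set (set X)}
    {H : set nat} {x : nat -> X} :
  sequentially_compact X -> basis B -> infinite_set H ->
  (forall U, B U ->
    finite_set (H `&` x @^-1` U) \/ finite_set (H `\` x @^-1` U)) ->
  converges_along H x.
Proof.
move=> X_sc [B_open B_nbhs] /infiniteP/card_leRP[R [Rtot Rinj]] unsplit.
have /choice[e eP] n : exists m, H m /\ R n m.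
  by have [m] := Rtot n I; exists m.
have e_inj : injective e.
  move=> m n emn; apply: (Rinj _ _ (e m)) => //; first exact: (eP m).2.
  by rewrite emn; exact: (eP n).2.
have [K [infK [l Kl]]] := X_sc (x \o e).
exists l => W /B_nbhs[U [BU Ul] UW].
have Unbhs : nbhs l U by apply: open_nbhs_nbhs; split=> //; exact: B_open.
have [N _ KU] := Kl _ Unbhs.
have infHU : infinite_set (H `&` x @^-1` U).
  pose K' := K `\` `I_N.
  have infK' : infinite_set K' by exact: infinite_setD.
  apply: (@sub_infinite_set _ (e @` K')).
    move=> _ [n [Kn /negP nN] <-]; split; first exact: (eP n).1.
    by apply: KU => //=; rewrite leqNgt.
  by apply: infinite_image infK' => m n _ _; exact: e_inj.
case: (unsplit _ BU) => // /finite_nat_bounded[M HM].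
exists M => // n /= Mn Hn; apply: UW; apply: contrapT => nU.
by have := HM n (conj Hn nU); rewrite ltnNge Mn.
Qed.

Theorem theorem2p7 (L : Type) (L_lt_s : [set: L] #< splitting_number)
    (X : topologicalType) (X_sc : sequentially_compact X)
    (wX_lt_s : weight X #< splitting_number) :
  ssc L X.
Proof.
move=> x; set B := least_card (basis_nonempty X).
have [B_basis _] : is_least_card basis B := least_cardP _.
have infw : infinite_set (weight X).
  apply: (@sub_infinite_set _ (range inl)); first by move=> p; left.
  by apply: infinite_image infinite_nat => m n _ _ [].
have Bw : B #<= weight X.
  have inrB : (@inr nat (set X)) @` B #= B by apply: inj_card_eq => U V _ _ [].
  by rewrite -(card_le_eql inrB); apply: subset_card_le => p; right.
pose F := [set x iU.1 @^-1` iU.2 | iU in [set: L] `*` B].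
have [H infH Hunsplit] : exists2 H, infinite_set H &
    forall S, F S -> finite_set (H `&` S) \/ finite_set (H `\` S).
  apply: unsplit_exists => sF.
  apply: (not_card_le_setX infw Bw L_lt_s.2 wX_lt_s.2).
  exact: card_le_trans sF (card_image_le _ _).
exists H; split=> // i; apply: unsplit_converges_along X_sc B_basis infH _ => U BU.
by apply: Hunsplit; exists (i, U).
Qed.
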